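(* Assume: (A1) $\overline X$ has finite expectation, $\hat F(t,x)>0$ a.s. for all $(t,x)\in\mathbb R^+\times\mathbb R^+$, and there is a constant $L_{\hat F}\ge 0$ with $\operatorname{ess\,sup}_{\omega\in\Omega}|\hat F(t,x)-\hat F(t,\bar x)|\le L_{\hat F}|x-\bar x|$ for all $t,x,\bar x\in\mathbb R^+$. (A2) There exist an $\mathscr F_\infty\otimes\mathcal B(\mathbb R^+)$-measurable function $\overline F:\Omega\times\mathbb R^+\to(0,\infty)$ and a constant $L_{\overline F}\ge0$ such that $$\lim_{t\to\infty}\mathbb E\Big[\sup_{x\in\mathbb R^+}|\hat F(t,x)-\overline F(x)|\Big]=0,\qquad |\overline F(x)-\overline F(y)|\le L_{\overline F}|x-y|\quad\text{for all }x,y\in\mathbb R^+.$$ (A3) $\overline F(\omega,\cdot)\in C^1(\mathbb R^+)$ for almost every $\omega$. Define the pathwise hazard rate $h(\omega,x):=-\partial_x\overline F(\omega,x)/\overline F(\omega,x)$, $x\in\mathbb R^+$, and suppose that for almost every $\omega$ $$\lim_{x\to\infty}h(\omega,x)=\lambda(\omega)\in[0,\infty].$$ Let $\alpha^*$ be the optimal feedback associated with $\hat V$, i.e. $$\alpha^*(\omega,x)=\frac{\big(\partial_x\hat V(\omega,x)+\overline F(\omega,x)\big)^+}{2\overline F(\omega,x)}.$$ Then, for a.e. $\omega$, $$\lim_{x\to\infty}\alpha^*(\omega,x)=\begin{cases}\dfrac{1}{1+\sqrt{1+\lambda(\omega)/r}},&\lambda(\omega)<\infty,\\[2mm]0,&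\lambda(\omega)=\infty.\end{cases}$$
   Context: $\mathbb R^+=[0,\infty)$ and $r>0$ is fixed. $(\Omega,\mathscr F,(\mathscr F_t)_{t\ge0},\mathbb P)$ is a filtered probability space satisfying the usual conditions, with $(\mathscr F_t)$ generated by a Wiener process $W$ (augmented), and $\mathscr F_\infty=\bigvee_{t\ge0}\mathscr F_t\subseteq\mathscr F$. $\overline X$ is an $\mathscr F$-measurable nonnegative random variable with atomless law and unbounded support. $\hat F(t,x):=\mathbb P(\overline X>x\mid\mathscr F_t)$, understood as an adapted random field. For almost every $\omega$, $\hat V(\omega,\cdot)$ denotes the unique classical ($C^1$ on $\mathbb R^+$) solution of $$r\hat V(x)=\frac{\big|\big(\partial_x\hat V(x)+\overline F(\omega,x)\big)^+\big|^2}{4\overline F(\omega,x)},\quad x\in\mathbb R^+,\qquad \lim_{x\to\infty}\hat V(x)=0;$$ it is the value function of the pathwise deterministic control problem of maximizing $\int_0^\infty e^{-rs}\alpha_s(1-\alpha_s)\overline F\big(\omega,x+\int_0^s\alpha_u\,du\big)\,ds$ over deterministic measurable $\alpha:[0,\infty)\to[0,1]$. *)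

(* Defs.v *)
From HB Require Import structures.
From mathcomp Require Import all_boot all_order all_algebra.
From mathcomp Require Import all_classical all_reals all_analysis.

Set Implicit Arguments.
Unset Strict Implicit.
Unset Printing Implicit Defensive.

Import Order.TTheory GRing.Theory Num.Theory.
Import numFieldNormedType.Exports.

Local Open Scope classical_set_scope.
Local Open Scope ring_scope.

(* Functions on [0, +oo[ are represented by functions on R of which only the
   values on [0, +oo[ are used. *)
Definition Rplus (R : realType) : set R := [set x | 0 <= x].
Arguments Rplus {R}.

Section calculus_on_Rplus.
Context {R : realType}.
Implicit Types (f F V : R -> R) (x : R).

Definition diff_quotient f x (y : R) : R := (f y - f x) / (y - x).

(* The punctured neighborhoods of x are intersected with [0, +oo[: this is the
   usual derivative at x > 0, and the right derivative at x = 0. *)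
Definition deriveRplus f x : R :=
  lim (diff_quotient f x y @[y --> within Rplus x^']).

Definition derivableRplus f x : Prop :=
  cvg (diff_quotient f x y @[y --> within Rplus x^']).

Definition C1Rplus f : Prop :=
  (forall x, 0 <= x -> derivableRplus f x) /\
  {within Rplus, continuous (deriveRplus f)}.

Definition classical_solution (r : R) F V : Prop :=
  [/\ C1Rplus V,
      forall x, 0 <= x ->
        r * V x = `|Num.max (deriveRplus V x + F x) 0| ^+ 2 / (4 * F x) &
      V x @[x --> +oo] --> 0 ].

Definition feedback F V x : R :=
  Num.max (deriveRplus V x + F x) 0 / (2 * F x).

Definition hazard_rate F x : R := - deriveRplus F x / F x.

(* The case l = -oo is junk. *)
Definition limit_feedback (r : R) (l : \bar R) : R :=
  match l with
  | EFin l' => 1 / (1 + Num.sqrt (1 + l' / r))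
  | _ => 0
  end.

End calculus_on_Rplus.

Section laws.
Context {R : realType}.

Definition atomless d (T : measurableType d) (mu : set T -> \bar R) : Prop :=
  forall A, measurable A -> (0 < mu A)%E ->
    exists B, [/\ measurable B, B `<=` A & (0 < mu B < mu A)%E].

Definition law_support (mu : set R -> \bar R) : set R :=
  [set x | forall e : R, 0 < e -> (0 < mu (ball x e))%E].

End laws.

Section filtered_spaces.
Context d (Omega : measurableType d) (R : realType) (P : probability Omega R).
Implicit Types (G : set_system Omega) (Filt : R -> set_system Omega)
  (W : R -> Omega -> R) (Y Z : Omega -> R) (E : set Omega).

(* Only the times t >= 0 matter. *)
Record usual_filtration Filt : Prop := {
  usual_sigma : forall t : R, 0 <= t -> sigma_algebra setT (Filt t) ;
  usual_sub : forall t : R, 0 <= t -> Filt t `<=` measurable ;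
  usual_incr : forall s t : R, 0 <= s -> s <= t -> Filt s `<=` Filt t ;
  usual_complete : measure_is_complete P ;
  usual_null : P.-negligible `<=` Filt 0 ;
  usual_right_continuous : forall t : R, 0 <= t ->
    \bigcap_(s in [set s : R | t < s]) Filt s = Filt t }.

Definition Filt_infty Filt : set_system Omega :=
  <<s \bigcup_(t in Rplus) Filt t >>.

Definition natural_events W (t : R) : set_system Omega :=
  \bigcup_(s in [set s : R | 0 <= s <= t])
    preimage_set_system setT (W s) (measurable : set_system R).

Definition natural_filtration W (t : R) : set_system Omega :=
  <<s natural_events W t >>.

Definition augmented_filtration W (t : R) : set_system Omega :=
  <<s natural_events W t `|` P.-negligible >>.

(* The second argument of normal_prob is the standard deviation. *)
Record wiener_process W : Prop := {
  wiener_measurable : forall t : R, 0 <= t -> measurable_fun setT (W t) ;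
  wiener_start : {ae P, forall w, W 0 w = 0} ;
  wiener_continuous :
    {ae P, forall w, {within Rplus, continuous (fun t => W t w)}} ;
  wiener_indep : forall s t : R, 0 <= s -> s < t ->
    forall (A : set Omega) (B : set R),
    natural_filtration W s A -> measurable B ->
    P (A `&` [set w | B (W t w - W s w)%R]) =
      (P A * P [set w | B (W t w - W s w)%R])%E ;
  wiener_gauss : forall s t : R, 0 <= s -> s < t ->
    forall B : set R, measurable B ->
    P [set w | B (W t w - W s w)%R] = normal_prob 0 (Num.sqrt (t - s)) B }.

(* Z is a version of the conditional expectation of Y given the
   sigma-algebra G. *)
Definition is_cond_expectation G Y Z : Prop :=
  [/\ forall B : set R, measurable B -> G (Z @^-1` B),
      P.-integrable setT (EFin \o Z) &
      forall A, G A ->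
        (\int[P]_(w in A) (Z w)%:E = \int[P]_(w in A) (Y w)%:E)%E].

(* Z is a version of P(E | G). *)
Definition is_cond_probability G E Z : Prop :=
  is_cond_expectation G (\1_E : Omega -> R) Z.

End filtered_spaces.

(* Main.v *)
(* The argument is pathwise. Write a for the feedback, so that r V = F a^2 and
   V' <= F (2 a - 1), with equality where a > 0, and compare a with a constant c
   through G := r V - c^2 F = F (a^2 - c^2), whose derivative is
   F (r (2 a - 1) + h c^2) where a > 0. The limit is the root a in ]0, 1/2] of
   r (2 a - 1) + lambda a^2 = 0.
   If c is above it, then eventually G' > 0 wherever G > 0: once positive, G
   cannot decrease any more, contradicting V --> 0 and F > 0.
   If c is below it, then once negative, G decreases; hence c^2 F >= - G stays
   away from 0 and V' <= - (1 - 2 c) F sends V to -oo, contradicting V >= 0. *)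

Require Import Defs.
From HB Require Import structures.
From mathcomp Require Import all_boot all_order all_algebra.
From mathcomp Require Import all_classical all_reals all_analysis.
From mathcomp Require Import ess_sup_inf.
From mathcomp Require Import ring lra.

Set Implicit Arguments.
Unset Strict Implicit.
Unset Printing Implicit Defensive.

Import Order.TTheory GRing.Theory Num.Theory.
Import numFieldNormedType.Exports.

Local Open Scope classical_set_scope.
Local Open Scope ring_scope.

(** * Derivatives on the half-line and a barrier principle *)

(** For [0 < x] the half-line is a neighborhood of [x], so restricting the punctured filter to it
    changes nothing; the substitution [y = h + x] then gives the usual difference quotient. *)
Lemma is_derive_deriveRplus (R : realType) (f : R -> R) (x : R) :
  0 < x -> derivableRplus f x -> is_derive x 1 f (deriveRplus f x).
Proof.
move=> x0 fx.
have : diff_quotient f x y @[y --> x^'] --> deriveRplus f x.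
  have -> : x^' = within Rplus x^'; last exact: fx.
  apply/seteqP; split => A; rewrite /within /=; first exact: filterS.
  move=> xA; have : nbhs x^' (@Rplus R).
    by apply: nbhs_dnbhs; near=> y; apply/ltW; near: y; exact: lt_nbhsr.
  by apply: filterS2 xA => y; apply.
rewrite /diff_quotient => fl.
have {}fl : h^-1 *: ((f \o shift x) (h *: 1) - f x) @[h --> 0^'] -->
    deriveRplus f x.
  have sx : h + x @[h --> (0 : R)^'] --> x^'.
    have sx : h + x @[h --> (0 : R)] --> x.
      by rewrite -[X in _ --> X]add0r; apply: cvgD; [exact: cvg_id | exact: cvg_cst].
    move=> A xA; have {}xA : \forall y \near x, y != x -> A y := xA.
    have : \forall h \near (0 : R), h + x != x -> A (h + x) := sx _ xA.
    suff: (\forall h \near (0 : R), h + x != x -> A (h + x)) ->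
      \forall h \near (0 : R), h != 0 -> A (h + x) by exact.
    apply: filterS => h + h0; apply.
    by rewrite -subr_eq0 addrK.
  have := cvg_comp _ _ sx fl; apply: cvg_trans; apply: near_eq_cvg.
  by near=> h; rewrite /= [h *: 1]mulr1 addrK mulrC.
by apply: DeriveDef; [apply/cvg_ex; eexists; exact: fl | exact: cvg_lim fl].
Unshelve. all: by end_near. Qed.

(** Barrier principle: the sign of [f'] matters only where [f] has not dropped below [f a]. A
    maximum point [p] of [f] on [[a, b]] satisfies [f a <= f p], so [0 < f' p]; if [p < b], then [f]
    would exceed its maximum just to the right of [p]. Hence [p = b]. *)
Lemma ge_of_derive_gt0 (R : realType) (f f' : R -> R) (a : R) :
  (forall x, a <= x -> is_derive x 1 f (f' x)) ->
  (forall x, a <= x -> f a <= f x -> 0 < f' x) ->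
  forall x, a <= x -> f a <= f x.
Proof.
move=> df f'0 b ab.
have [|p /[!in_itv]/= /andP[ap pb] pmax] := @EVT_max R f a b ab.
  apply: derivable_within_continuous => x /[!in_itv]/= /andP[ax _].
  by have [] := df x ax.
have fap : f a <= f p by apply: pmax; rewrite in_itv /= lexx.
move: pb; rewrite le_eqVlt => /predU1P[<- //|pb]; exfalso.
have [dp dpE] := df p ap.
have : h^-1 *: ((f \o shift p) (h *: 1) - f p) @[h --> 0^'] --> f' p.
  by rewrite -dpE; exact: dp.
move=> /cvg_dnbhs_at_right/cvgr_gt/(_ _ (f'0 _ ap fap)) fp.
have bp0 : 0 < b - p by rewrite subr_gt0.
have [h [[h0 hb]]] := @filter_ex _ (0 : R)^'+ _ _
  (filterI (filterI (nbhs_right_gt 0) (nbhs_right_lt bp0)) fp).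
rewrite /= pmulr_rgt0 ?invr_gt0// subr_gt0 ltNge => /negP; apply.
apply: pmax; rewrite in_itv /= [h *: 1]mulr1; apply/andP; split; lra.
Qed.

(** * The equation for [V] in terms of the feedback *)

Lemma feedback_ge0 (R : realType) (F V : R -> R) (x : R) :
  0 < F x -> 0 <= feedback F V x.
Proof.
by move=> F0; rewrite divr_ge0 ?mulr_ge0 ?(ltW F0)// le_max lexx orbT.
Qed.

Lemma deriveRplus_le_feedback (R : realType) (F V : R -> R) (x : R) :
  0 < F x -> deriveRplus V x <= F x * (2 * feedback F V x - 1).
Proof.
move=> F0.
have -> : F x * (2 * feedback F V x - 1) = Num.max (deriveRplus V x + F x) 0 - F x.
  by rewrite /feedback; field; rewrite gt_eqF.
by rewrite lerBrDr le_max lexx.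
Qed.

Lemma deriveRplus_feedback (R : realType) (F V : R -> R) (x : R) :
  0 < F x -> 0 < feedback F V x ->
  deriveRplus V x = F x * (2 * feedback F V x - 1).
Proof.
move=> F0; rewrite /feedback; case: (ltP (_ + _) 0) => [_|le0 _].
  by rewrite mul0r ltxx.
by field; rewrite gt_eqF.
Qed.

Lemma solution_feedback (R : realType) (r : R) (F V : R -> R) (x : R) :
  classical_solution r F V -> 0 <= x -> 0 < F x ->
  r * V x = F x * feedback F V x ^+ 2.
Proof.
move=> [_ rV _] x0 F0; rewrite rV// ger0_norm ?le_max ?lexx ?orbT//.
by rewrite /feedback; field; rewrite gt_eqF.
Qed.

(** * Comparison of the feedback with constants *)

Section asymptotics.
Context {R : realType} (r : R) (F V : R -> R).
Hypotheses (r0 : 0 < r) (F0 : forall x : R, 0 <= x -> 0 < F x).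
Hypotheses (F1 : C1Rplus F) (VF : classical_solution r F V).

Local Notation a := (feedback F V).
Local Notation h := (hazard_rate F).

(** This is the function [G] of the argument above; since [F > 0], its sign tells on which side of
    [c >= 0] the feedback lies. *)
Let gap (c x : R) : R := r * V x - c ^+ 2 * F x.

Let gapE (c x : R) : 0 <= x -> gap c x = F x * (a x ^+ 2 - c ^+ 2).
Proof. by move=> x0; rewrite /gap (solution_feedback VF)// ?F0//; ring. Qed.

Let gap' (c x : R) : R := r * deriveRplus V x - c ^+ 2 * deriveRplus F x.

Let is_derive_V (x : R) : 0 < x -> is_derive x 1 V (deriveRplus V x).
Proof.
by case: VF => -[V1 _] _ _ x0; apply: is_derive_deriveRplus => //; exact/V1/ltW.
Qed.

Let is_derive_F (x : R) : 0 < x -> is_derive x 1 F (deriveRplus F x).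
Proof.
by case: F1 => F1' _ x0; apply: is_derive_deriveRplus => //; exact/F1'/ltW.
Qed.

Let is_derive_gap (c x : R) : 0 < x -> is_derive x 1 (gap c) (gap' c x).
Proof.
move=> x0; have dV := is_derive_V x0; have dF := is_derive_F x0.
exact: (is_deriveB (is_deriveZ r dV) (is_deriveZ (c ^+ 2) dF)).
Qed.

Let deriveRplusF (x : R) : 0 < x -> deriveRplus F x = - (h x * F x).
Proof.
by move=> x0; rewrite /hazard_rate divfK ?opprK// gt_eqF// F0// ltW.
Qed.

(** The last assumption is the sign of [gap' / F] at [a = c] and [h = m]; it persists when [a] and
    [h] grow. *)
Lemma feedback_le (c m x0 : R) : 0 < x0 -> 0 <= c ->
  (forall x, x0 <= x -> m <= h x) -> 0 < r * (2 * c - 1) + m * c ^+ 2 ->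
  forall x, x0 <= x -> a x <= c.
Proof.
move=> x00 c0 hm cm x1 x01; rewrite leNgt; apply/negP => ca.
have x1x0 x : x1 <= x -> 0 < x by move=> /(le_trans x01)/(lt_le_trans x00).
have x1F x : x1 <= x -> 0 < F x by move=> /x1x0/ltW/F0.
have gap1 : 0 < gap c x1.
  rewrite gapE ?(ltW (x1x0 _ _))// pmulr_rgt0 ?x1F// subr_gt0 ltr_pXn2r// nnegrE//.
  by rewrite (le_trans c0)// ltW.
have gap_ge x : x1 <= x -> gap c x1 <= gap c x.
  apply: (@ge_of_derive_gt0 _ _ (gap' c)) => {}x x1x.
    exact/is_derive_gap/x1x0.
  move=> /(lt_le_trans gap1); rewrite gapE; last exact/ltW/x1x0.
  rewrite pmulr_rgt0 ?x1F// subr_gt0 => ca2.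
  have {ca2} cax : c < a x.
    by rewrite ltNge; apply: contraTN ca2 => ac; rewrite -leNgt lerXn2r// nnegrE
      feedback_ge0// x1F.
  rewrite /gap' (deriveRplusF (x1x0 _ x1x)).
  (* A lower bound on [V'] needs the equality case, available because [0 <= c < a x]. *)
  rewrite (@deriveRplus_feedback _ F) ?x1F//; last first.
    exact: le_lt_trans cax.
  have -> : r * (F x * (2 * a x - 1)) - c ^+ 2 * - (h x * F x) =
    F x * (r * (2 * a x - 1) + h x * c ^+ 2) by ring.
  rewrite mulr_gt0 ?x1F// (lt_le_trans cm)// lerD//.
    by rewrite ler_pM2l//; lra.
  by rewrite ler_wpM2r ?sqr_ge0// hm// (le_trans x01).
(* Since [gap c x <= r * V x] and [V] tends to 0, [gap c x] falls below [gap c x1] for some large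
   [x]. *)
have [_ _ V0] := VF.
have rV : r * V x @[x --> +oo] --> 0.
  by rewrite -(mulr0 r); apply: cvgM => //; exact: cvg_cst.
have [x [rVx x1x]] := @filter_ex _ (pinfty_nbhs R) _ _
  (filterI (cvgr_lt _ rV _ gap1) (nbhs_pinfty_ge (num_real x1))).
have := gap_ge x x1x; apply/negP; rewrite -ltNge (le_lt_trans _ rVx)//.
by rewrite /gap lerBlDr lerDl mulr_ge0 ?sqr_ge0// ltW// x1F.
Qed.

Lemma feedback_ge (c m x0 : R) : 0 < x0 -> c < 1 / 2 ->
  (forall x, x0 <= x -> h x <= m) -> r * (2 * c - 1) + m * c ^+ 2 < 0 ->
  forall x, x0 <= x -> c <= a x.
Proof.
move=> x00 c12 hm cm x1 x01; rewrite leNgt; apply/negP => ac.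
have x1x0 x : x1 <= x -> 0 < x by move=> /(le_trans x01)/(lt_le_trans x00).
have x1F x : x1 <= x -> 0 < F x by move=> /x1x0/ltW/F0.
have a0 x : x1 <= x -> 0 <= a x by move=> x1x; rewrite feedback_ge0// x1F.
(* The sign of [c] comes from the assumption to be refuted: [0 <= a x1 < c]. *)
have c0 : 0 < c by rewrite (le_lt_trans _ ac)// a0.
have gap1 : gap c x1 < 0.
  rewrite gapE ?(ltW (x1x0 _ _))// pmulr_rlt0 ?x1F// subr_lt0 ltr_pXn2r// nnegrE ?a0//.
  exact: ltW.
have gap_le0 x : x1 <= x -> gap c x <= gap c x1 -> a x < c.
  move=> x1x /le_lt_trans/(_ gap1); rewrite gapE; last exact/ltW/x1x0.
  rewrite pmulr_rlt0 ?x1F// subr_lt0 ltNge => ca2.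
  rewrite ltNge; apply: contra ca2 => ca.
  by rewrite lerXn2r// nnegrE ?a0// ltW.
have gap_le x : x1 <= x -> gap c x <= gap c x1.
  move=> x1x; rewrite -lerN2.
  apply: (@ge_of_derive_gt0 _ (- gap c) (- gap' c) x1) => // {x1x}x x1x.
    exact/is_deriveN/is_derive_gap/x1x0.
  rewrite lerN2 oppr_gt0 => /(gap_le0 _ x1x) acx.
  rewrite /gap' (deriveRplusF (x1x0 _ x1x)).
  (* The feedback may vanish here, but an upper bound on [V'] is enough. *)
  have V'le := deriveRplus_le_feedback V (x1F _ x1x).
  apply: (@le_lt_trans _ _ (F x * (r * (2 * a x - 1) + h x * c ^+ 2))).
    have -> : F x * (r * (2 * a x - 1) + h x * c ^+ 2) =
      r * (F x * (2 * a x - 1)) - c ^+ 2 * - (h x * F x) by ring.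
    by rewrite lerD2r ler_pM2l.
  rewrite pmulr_rlt0 ?x1F// (le_lt_trans _ cm)// lerD//.
    by rewrite ler_pM2l//; lra.
  by rewrite ler_wpM2r ?sqr_ge0// hm// (le_trans x01).
have V0 x : x1 <= x -> 0 <= V x.
  move=> x1x; rewrite -(pmulr_rge0 _ r0) (solution_feedback VF) ?x1F//.
    by rewrite mulr_ge0 ?sqr_ge0// ltW// x1F.
  exact/ltW/x1x0.
have Fge x : x1 <= x -> - gap c x1 / c ^+ 2 <= F x.
  move=> x1x; rewrite ler_pdivrMr ?exprn_gt0// (le_trans (y := - gap c x))//.
    by rewrite lerN2 gap_le.
  by rewrite /gap opprB lerBlDr mulrC lerDl mulr_ge0 ?V0// ltW.
(* The lower bound on [F] times [1 - 2 * c], which is positive as [c < 1 / 2]: a uniform rate of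
   decrease of [V]. *)
pose k := - gap c x1 / c ^+ 2 * (1 - 2 * c).
have k0 : 0 < k by rewrite !mulr_gt0 ?invr_gt0 ?exprn_gt0 ?oppr_gt0//; lra.
have V'k x : x1 <= x -> deriveRplus V x <= - k.
  move=> x1x; apply: (le_trans (deriveRplus_le_feedback V (x1F _ x1x))).
  apply: (@le_trans _ _ (F x * (2 * c - 1))).
    by rewrite ler_pM2l ?x1F//; have := gap_le0 x x1x (gap_le x x1x); lra.
  have := Fge x x1x; rewrite /k; nra.
(* Half of the rate [k] is given up to obtain the strict sign required by the barrier principle. *)
have Vle x : x1 <= x -> V x + k / 2 * x <= V x1 + k / 2 * x1.
  move=> x1x; rewrite -lerN2.
  apply: (@ge_of_derive_gt0 _ (fun x => - (V x + k / 2 * x))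
    (fun x => - (deriveRplus V x + k / 2)) x1) => // {x1x}x x1x.
    have dV := is_derive_V (x1x0 _ x1x).
    have := is_deriveN (is_deriveD dV (is_deriveZ (k / 2) (is_derive_id x 1))).
    by rewrite /GRing.scale /= mulr1.
  by move=> _; have := V'k x x1x; lra.
(* Chosen so that [k / 2 * (x2 - x1) = V x1 + 1], which forces [V x2 <= -1]. *)
pose x2 := x1 + (V x1 + 1) * (2 / k).
have x12 : x1 <= x2.
  by rewrite lerDl mulr_ge0 ?divr_ge0 ?addr_ge0 ?V0// ltW.
have := Vle x2 x12; have := V0 x2 x12.
have -> : k / 2 * x2 = k / 2 * x1 + V x1 + 1.
  by rewrite /x2; field; rewrite gt_eqF.
lra.
Qed.

End asymptotics.

(** * The limiting quadratic equation and convergence of the feedback *)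

(** With [s] the square root, [l = r * (s ^+ 2 - 1)] turns the equation into a rational identity in
    [s], and [a <= 1 / 2] amounts to [1 <= s]. *)
Lemma limit_feedback_root (R : realType) (r l : R) : 0 < r -> 0 <= l ->
  let a := limit_feedback r l%:E in
  [/\ 0 < a, a <= 1 / 2 & r * (2 * a - 1) + l * a ^+ 2 = 0].
Proof.
move=> r0 l0 /=.
have lr0 : 0 <= l / r by rewrite divr_ge0// ltW.
set s := Num.sqrt (1 + l / r).
have s2 : s ^+ 2 = 1 + l / r by rewrite sqr_sqrtr// addr_ge0.
have s1 : 1 <= s by rewrite -sqrtr1 ler_wsqrtr// lerDl.
have s10 : 0 < 1 + s by lra.
split; first by rewrite divr_gt0.
  by rewrite ler_pdivrMr//; lra.
have -> : l = r * (s ^+ 2 - 1) by rewrite s2; field; rewrite gt_eqF.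
by field; rewrite gt_eqF.
Qed.

Lemma feedback_cvg (R : realType) (r : R) (F V : R -> R) (l : \bar R) :
  0 < r -> (forall x : R, 0 <= x -> 0 < F x) -> C1Rplus F ->
  classical_solution r F V -> (0 <= l)%E ->
  (hazard_rate F x)%:E @[x --> +oo] --> l ->
  feedback F V x @[x --> +oo] --> limit_feedback r l.
Proof.
move=> r0 F0 F1 VF l0 hl.
(* Any [m] strictly below [l] is eventually a lower bound of the hazard rate. In
   [Num.max 1 (x1 + 1)], the 1 ensures positivity and the shift lands strictly beyond [x1]. *)
have near_le c m : 0 <= c -> (m%:E < l)%E -> 0 < r * (2 * c - 1) + m * c ^+ 2 ->
    \forall x \near +oo, feedback F V x <= c.
  move=> c0 ml cm.
  have [x1 [_ hm]] := hl _ (open_ereal_gt' ml).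
  near=> x; apply: (feedback_le r0 F0 F1 VF (x0 := Num.max 1 (x1 + 1)) _ c0 _ cm).
  - by rewrite lt_max ltr01.
  - move=> y; rewrite ge_max => /andP[_ x1y]; rewrite -lee_fin ltW// hm//; lra.
  - by near: x; apply: nbhs_pinfty_ge; exact: num_real.
have near_ge c m : c < 1 / 2 -> (l < m%:E)%E -> r * (2 * c - 1) + m * c ^+ 2 < 0 ->
    \forall x \near +oo, c <= feedback F V x.
  move=> c12 lm cm.
  have [x1 [_ hm]] := hl _ (open_ereal_lt' lm).
  near=> x; apply: (feedback_ge r0 F0 F1 VF (x0 := Num.max 1 (x1 + 1)) _ c12 _ cm).
  - by rewrite lt_max ltr01.
  - move=> y; rewrite ge_max => /andP[_ x1y]; rewrite -lee_fin ltW// hm//; lra.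
  - by near: x; apply: nbhs_pinfty_ge; exact: num_real.
have near_ge0 : \forall x \near +oo, 0 <= feedback F V x.
  near=> x; apply/feedback_ge0/F0; near: x; apply: nbhs_pinfty_ge.
  exact: num_real.
apply/cvgrPdist_le => e e0.
case: l l0 hl near_le near_ge => [l| |//] l0 hl near_le near_ge; last first.
  have : \forall x \near +oo, feedback F V x <= e.
    (* When [l] is infinite every [m] is allowed; this one makes the sign condition read
       [0 < 2 * r * e]. *)
    apply: (near_le _ (r / e ^+ 2)); rewrite ?ltry ?ltW// divfK; last first.
      by rewrite gt_eqF// exprn_gt0.
    by have := mulr_gt0 r0 e0; lra.
  move=> near_e; near=> x; rewrite /= sub0r normrN ger0_norm; first by near: x.
  by near: x.
rewrite lee_fin in l0.
have [] := limit_feedback_root r0 l0; set a := limit_feedback r l%:E => a0 a12 aE.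
have up : \forall x \near +oo, feedback F V x <= a + e.
  have ae2 : 0 < (a + e) ^+ 2 by rewrite exprn_gt0// addr_gt0.
  have d0 : 0 < r * (2 * (a + e) - 1) + l * (a + e) ^+ 2.
    have -> : r * (2 * (a + e) - 1) + l * (a + e) ^+ 2 =
      r * (2 * a - 1) + l * a ^+ 2 + 2 * (r * e) + l * (2 * (a * e) + e ^+ 2).
      by ring.
    rewrite aE add0r ltr_wpDr ?mulr_gt0// mulr_ge0// addr_ge0 ?sqr_ge0//.
    by rewrite ltW// !mulr_gt0.
  pose d := r * (2 * (a + e) - 1) + l * (a + e) ^+ 2.
  (* Lowering [l] by this amount halves the positive value [d] of the quadratic at [a + e]. *)
  apply: (near_le _ (l - d / (2 * (a + e) ^+ 2))).
  - by rewrite ltW// addr_gt0.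
  - by rewrite lte_fin ltrBlDr ltrDl divr_gt0// mulr_gt0.
  - have -> : r * (2 * (a + e) - 1) + (l - d / (2 * (a + e) ^+ 2)) * (a + e) ^+ 2
      = d / 2 by rewrite /d; field; rewrite gt_eqF// addr_gt0.
    by rewrite divr_gt0.
have down : \forall x \near +oo, a - e <= feedback F V x.
  (* If [a - e <= 0], nonnegativity of the feedback suffices. *)
  have [ae|ae] := leP (a - e) 0.
    by apply: filterS near_ge0 => x; exact: le_trans.
  pose d := r * (2 * (a - e) - 1) + l * (a - e) ^+ 2.
  have d0 : d < 0.
    have -> : d = r * (2 * a - 1) + l * a ^+ 2 - (2 * (r * e) +
      l * (e * (a + (a - e)))) by rewrite /d; ring.
    rewrite aE sub0r oppr_lt0 ltr_wpDr ?mulr_gt0// mulr_ge0//.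
    by rewrite ltW// mulr_gt0// addr_gt0.
  (* Raising [l] by [- d] multiplies [d] by [1 - (a - e) ^+ 2], which is positive because
     [0 < a - e < 1]. *)
  apply: (near_ge _ (l - d)); first lra.
    by rewrite lte_fin ltrBrDr gtrDl.
  have -> : r * (2 * (a - e) - 1) + (l - d) * (a - e) ^+ 2 =
    d * (1 - (a - e) ^+ 2) by rewrite /d; ring.
  by rewrite nmulr_rlt0// subr_gt0 expr_lt1// ?ltW//; lra.
near=> x; rewrite distrC ler_distl; apply/andP; split; near: x.
  exact: down.
exact: up.
Unshelve. all: by end_near. Qed.

Theorem proposition4p8 (R : realType) (r : R) (r_gt0 : 0 < r)
  (d : measure_display) (Omega : measurableType d) (P : probability Omega R)
  (Filt : R -> set_system Omega) (W : R -> Omega -> R)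
  (Filt_usual : usual_filtration P Filt)
  (W_wiener : wiener_process P W)
  (Filt_W : forall t : R, 0 <= t -> Filt t = augmented_filtration P W t)
  (X : {RV P >-> R})
  (X_ge0 : forall w, 0 <= X w)
  (X_atomless : atomless (distribution P X))
  (X_unbounded : ~ bounded_set (law_support (distribution P X)))
  (Fhat : R -> R -> Omega -> R)
  (Fhat_cond : forall t x : R, 0 <= t -> 0 <= x ->
     is_cond_probability P (Filt t) [set w | x < X w] (Fhat t x))
  (X_integrable : P.-integrable setT (EFin \o X))
  (Fhat_gt0 : forall t x : R, 0 <= t -> 0 <= x ->
     {ae P, forall w, 0 < Fhat t x w})
  (Fhat_lip : exists2 L : R, 0 <= L & forall t x y : R,
     0 <= t -> 0 <= x -> 0 <= y ->
     (ess_sup P (fun w => `|Fhat t x w - Fhat t y w|%:E)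
        <= (L * `|x - y|)%:E)%E)
  (Fbar : Omega -> R -> R)
  (Fbar_meas : measurable_fun
     ([set: g_sigma_algebraType (Filt_infty Filt)] `*` @Rplus R)
     (fun p : g_sigma_algebraType (Filt_infty Filt) * R => Fbar p.1 p.2))
  (Fbar_gt0 : forall w (x : R), 0 <= x -> 0 < Fbar w x)
  (Fhat_Fbar :
     (\int[P]_w ereal_sup [set `|Fhat t x w - Fbar w x|%:E | x in @Rplus R])%E
       @[t --> +oo] --> 0%E)
  (Fbar_lip : exists2 L : R, 0 <= L & {ae P, forall w, forall x y : R,
     0 <= x -> 0 <= y -> `|Fbar w x - Fbar w y| <= L * `|x - y|})
  (Fbar_C1 : {ae P, forall w, C1Rplus (Fbar w)})
  (Vhat : Omega -> R -> R)
  (Vhat_sol : {ae P, forall w, classical_solution r (Fbar w) (Vhat w)})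
  (lambda : Omega -> \bar R)
  (hazard_lambda : {ae P, forall w, (0 <= lambda w)%E /\
     (hazard_rate (Fbar w) x)%:E @[x --> +oo] --> lambda w}) :
  {ae P, forall w,
     feedback (Fbar w) (Vhat w) x @[x --> +oo] -->
       limit_feedback r (lambda w)}.
Proof.
(* The three almost sure properties hold together off a null set, where the deterministic limit
   applies path by path. *)
move: Fbar_C1 Vhat_sol hazard_lambda; apply: filterS3 => w F1 VF [l0 hl].
exact: feedback_cvg (Fbar_gt0 w) F1 VF l0 hl.
Qed.
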